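(* Let $\mathrm{un}(n)$ be the bound for the absolute value of the leftmost root of the univariate Eulerian polynomial $A_n(x)$ obtained from the determinant of the relaxation of the univariate Eulerian polynomial, and, for a sequence $y\colon\mathbb{N}\to\mathbb{R}$, let $\mathrm{mult}_v(n)$ be the bound obtained from the relaxation of the multivariate Eulerian polynomial $A_n(x_1,\dots,x_{n+1})$ by linearizing with the vectors $v=v_n=(y(n),0,1,-1,\dots,-1)\in\mathbb{R}^{n+2}$ (both defined in the context). Then there exists a sequence $y\colon\mathbb{N}\to\mathbb{R}$ such that, for all $n$ big enough, the difference $\mathrm{mult}_v(n)-\mathrm{un}(n)$ is positive, and $$\mathrm{mult}_v(n)-\mathrm{un}(n)\sim\frac12\left(\frac34\right)^n\quad (n\to\infty),$$ i.e. the quotient of the two sides tends to $1$.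
   Context: Permutations $\sigma\in\mathfrak{S}_{n+1}$ of $[n+1]=\{1,\dots,n+1\}$ are written in one-line notation $\sigma_1\cdots\sigma_{n+1}$. The descent top set of $\sigma$ is $\mathcal{DT}(\sigma)=\{\sigma_i\mid i\in[n],\ \sigma_i>\sigma_{i+1}\}$. The multivariate Eulerian polynomial is $A_n(x_1,\dots,x_{n+1})=\sum_{\sigma\in\mathfrak{S}_{n+1}}\prod_{i\in\mathcal{DT}(\sigma)}x_i$ (the variable $x_1$ never actually occurs), and the univariate Eulerian polynomial is $A_n(x)=A_n(x,\dots,x)=\sum_{\sigma\in\mathfrak{S}_{n+1}}x^{\mathrm{des}(\sigma)}$ with $\mathrm{des}(\sigma)=|\{i\mid\sigma_i>\sigma_{i+1}\}|$. Its roots are real and negative, $q_1^{(n)}<\cdots<q_n^{(n)}<0$, and it is palindromic. For a real polynomial $p$ in variables $\mathbf{x}=(x_1,\dots,x_m)$ with $p(0)\neq0$, the linear form $L_p$ on $\mathbb{R}[\mathbf{x}]$ is defined by $L_p(1)=\deg p$ and the formal power series identity $-\log\frac{p(-\mathbf{x})}{p(0)}=\sum_{\alpha\in\mathbb{N}_0^m,\alpha\ne0}\frac1{|\alpha|}\binom{|\alpha|}{\alpha}L_p(\mathbf{x}^\alpha)\mathbf{x}^\alpha$. Let $Q=(1,x_1,\dots,x_m)^T(1,x_1,\dots,x_m)$. The pencil (relaxation) associated with $p$ is the linear matrix polynomial $M_p(\mathbf{x})=B_0+\sum_{i=1}^m x_iB_i$ of size $m+1$, where $B_0$ is obtained by applying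 $L_p$ to each entry of $Q$ and $B_i$ by applying $L_p$ to each entry of $x_iQ$. Univariate bound: for $p=A_n(x)$ (one variable, $2\times2$ pencil) write $\det M_p(x)=c+bx+ax^2$ and set $\mathrm{un}(n)=\frac{2a}{b-\sqrt{b^2-4ac}}$ (for $n\geq 2$). Multivariate bound: for $p=A_n(x_1,\dots,x_{n+1})$ (pencil of size $n+2$) and $v=v_n=(y(n),0,1,-1,\dots,-1)\in\mathbb{R}^{n+2}$ (with $n-1$ entries $-1$), write $v^TM_p(x,\dots,x)v=D+xN$ with $D,N\in\mathbb{R}$ depending on $n$ and $y(n)$. When $D,N>0$ this gives $q_n^{(n)}\geq-D/N$ and hence, by palindromicity, $|q_1^{(n)}|\geq N/D$; set $\mathrm{mult}_v(n)=N/D$. *)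

(* Defs.v *)
From HB Require Import structures.
From mathcomp Require Import all_boot all_order all_algebra all_fingroup.
From mathcomp.multinomials Require Import ssrcomplements mpoly.

Set Implicit Arguments.
Unset Strict Implicit.
Unset Printing Implicit Defensive.

Import Order.TTheory GRing.Theory Num.Theory.
Local Open Scope ring_scope.

(* Permutations of [n+1] are elements of 'S_n.+1 acting on {0, ..., n}: the
   letter k of [n+1] is the ordinal k - 1, and x_k is the variable 'X_(k - 1). *)

Definition is_descent n (s : 'S_n.+1) (i : 'I_n) : bool :=
  (s (lift ord0 i) < s (widen_ord (leqnSn n) i))%N.

Definition descent_tops n (s : 'S_n.+1) : {set 'I_n.+1} :=
  [set s (widen_ord (leqnSn n) i) | i : 'I_n & is_descent s i].

Definition des n (s : 'S_n.+1) : nat := #|[set i | is_descent s i]|.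

Definition eulerian_multi (R : rcfType) n : {mpoly R[n.+1]} :=
  \sum_(s : 'S_n.+1) \prod_(k in descent_tops s) 'X_k.

(* A_n(x, ..., x), in {mpoly R[1]} rather than {poly R}, so that the linear form
   and the pencil below apply to it. *)
Definition eulerian_uni (R : rcfType) n : {mpoly R[1]} :=
  eulerian_multi R n \mPo [tuple 'X_ord0 | _ < n.+1].

Lemma eulerian_uniE (R : rcfType) n :
  eulerian_uni R n = \sum_(s : 'S_n.+1) 'X_ord0 ^+ des s.
Proof.
rewrite /eulerian_uni /eulerian_multi raddf_sum /=; apply: eq_bigr => s _.
rewrite rmorph_prod /=.
rewrite (eq_bigr (fun=> 'X_ord0)); last first.
  by move=> k _; rewrite comp_mpolyXU -tnth_nth tnth_mktuple.
rewrite prodr_const card_imset // => i j /perm_inj /(congr1 val) /= ij.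
exact: val_inj.
Qed.

(* Coefficient of x^a in the formal power series
   log f = \sum_(k >= 1) (-1)^(k+1) (f - 1)^k / k, for f with f(0) = 1.  The
   terms with k > |a| do not contribute (log_coef_stable), so the sum stops. *)
Definition log_coef (R : rcfType) m (f : {mpoly R[m]}) (a : 'X_{1..m}) : R :=
  \sum_(1 <= k < (mdeg a).+1) (-1) ^+ k.+1 / k%:R * ((f - 1) ^+ k)@_a.

Lemma mcoeff_exp_lowdeg (R : rcfType) m (u : {mpoly R[m]}) k (a : 'X_{1..m}) :
  u@_0%MM = 0 -> (mdeg a < k)%N -> (u ^+ k)@_a = 0.
Proof.
move=> u0; elim: k a => [//|k IH] a ak.
rewrite exprS mcoeffM big1 // => -[b c] /= /eqP E.
have [->|b0] := eqVneq (b : 'X_{1..m}) 0%MM; first by rewrite u0 mul0r.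
rewrite [X in _ * X]IH ?mulr0 //; move/(congr1 mdeg): E; rewrite mdegD => E.
move: ak; rewrite {1}E ltnS; apply: leq_trans.
by rewrite -[X in (X < _)%N]add0n ltn_add2r lt0n mdeg_eq0.
Qed.

Lemma log_coef_stable (R : rcfType) m (f : {mpoly R[m]}) (a : 'X_{1..m}) K :
  f@_0%MM = 1 -> (mdeg a <= K)%N ->
  \sum_(1 <= k < K.+1) (-1) ^+ k.+1 / k%:R * ((f - 1) ^+ k)@_a = log_coef f a.
Proof.
move=> f0 aK; rewrite (big_cat_nat (n := (mdeg a).+1)) //=.
rewrite [X in _ + X]big_nat_cond [X in _ + X]big1 ?addr0 //.
move=> k /andP[/andP[ak _] _]; rewrite mcoeff_exp_lowdeg ?mulr0 //.
by rewrite mcoeffB f0 mcoeff1 eqxx subrr.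
Qed.

Definition multinomial_coef (R : rcfType) m (a : 'X_{1..m}) : R :=
  (mdeg a)`!%:R / (\prod_(i < m) (a i)`!)%:R.

(* p(-x) / p(0) *)
Definition normalized_opp (R : rcfType) m (p : {mpoly R[m]}) : {mpoly R[m]} :=
  (p.@[fun=> 0])^-1 *: (p \mPo [tuple - 'X_i | i < m]).

(* L_p(x^a), solved from the defining power series identity (Lform_log). *)
Definition Lform_monomial (R : rcfType) m (p : {mpoly R[m]}) (a : 'X_{1..m}) : R :=
  if a == 0%MM then (msize p).-1%:R
  else (mdeg a)%:R / multinomial_coef R a * - log_coef (normalized_opp p) a.

Definition Lform (R : rcfType) m (p q : {mpoly R[m]}) : R :=
  \sum_(a <- msupp q) q@_a * Lform_monomial p a.

Lemma LformX (R : rcfType) m (p : {mpoly R[m]}) (a : 'X_{1..m}) :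
  Lform p 'X_[a] = Lform_monomial p a.
Proof. by rewrite /Lform msuppX big_seq1 mcoeffX eqxx mul1r. Qed.

Lemma Lform1 (R : rcfType) m (p : {mpoly R[m]}) : Lform p 1 = (msize p).-1%:R.
Proof. by rewrite -mpolyX0 LformX /Lform_monomial eqxx. Qed.

Lemma Lform_log (R : rcfType) m (p : {mpoly R[m]}) (a : 'X_{1..m}) :
  a != 0%MM ->
  - log_coef (normalized_opp p) a =
    (mdeg a)%:R^-1 * multinomial_coef R a * Lform p 'X_[a].
Proof.
move=> a0; rewrite LformX /Lform_monomial (negPf a0).
have d0 : (mdeg a)%:R != 0 :> R by rewrite pnatr_eq0 mdeg_eq0.
have c0 : multinomial_coef R a != 0.
  rewrite mulf_neq0 ?invr_eq0 ?pnatr_eq0 -?lt0n ?fact_gt0 // prodn_gt0 // => i.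
  exact: fact_gt0.
by rewrite mulrA mulrACA mulVf // divff // mul1r mul1r.
Qed.

Lemma Lform_linear (R : rcfType) m (p : {mpoly R[m]}) : scalar (Lform p).
Proof.
have LE d q : (msize q <= d)%N ->
    Lform p q = \sum_(a : 'X_{1..m < d}) q@_a * Lform_monomial p a.
  move=> qd; rewrite /Lform (big_mksub 'X_{1..m < d}) /=; first last.
  - by move=> x /msize_mdeg_lt /leq_trans; apply.
  - exact: msupp_uniq.
  rewrite big_rmcond //= => i; rewrite mcoeff_msupp negbK => /eqP ->.
  by rewrite mul0r.
move=> c q r; pose d := maxn (msize (c *: q + r)) (maxn (msize q) (msize r)).
rewrite !(LE d) ?leq_max ?leqnn ?orbT // big_distrr -big_split /=.
by apply: eq_bigr => a _; rewrite mcoeffD mcoeffZ mulrDl mulrA.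
Qed.

Definition monomial_row (R : rcfType) m : 'rV[{mpoly R[m]}]_m.+1 :=
  \row_j (if unlift ord0 j is Some i then 'X_i else 1).

Definition Qmx (R : rcfType) m : 'M[{mpoly R[m]}]_m.+1 :=
  (monomial_row R m)^T *m monomial_row R m.

Definition pencil (R : rcfType) m (p : {mpoly R[m]}) : 'M[{mpoly R[m]}]_m.+1 :=
  map_mx (@mpolyC m R) (map_mx (Lform p) (Qmx R m)) +
  \sum_(i < m) 'X_i *: map_mx (@mpolyC m R) (map_mx (Lform p) ('X_i *: Qmx R m)).

(* M_p(x, ..., x); this is M_p(x) when m = 1. *)
Definition pencil_diag (R : rcfType) m (p : {mpoly R[m]}) : 'M[{poly R}]_m.+1 :=
  map_mx (mmap (@polyC R) (fun=> 'X)) (pencil p).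

Lemma pencil_diagE (R : rcfType) m (p : {mpoly R[m]}) i j :
  pencil_diag p i j =
  (Lform p (Qmx R m i j))%:P +
  (\sum_(k < m) Lform p ('X_k * Qmx R m i j)) *: 'X.
Proof.
rewrite /pencil_diag /pencil mxE mxE summxE raddfD /= raddf_sum /=.
rewrite scaler_suml; congr (_ + _); first by rewrite !mxE mmapC.
apply: eq_bigr => k _.
rewrite mxE rmorphM /= mmapX mmap1U mxE mmapC mulrC mul_polyC mxE.
by congr (Lform p _ *: _); rewrite mxE.
Qed.

Lemma size_pencil_diag (R : rcfType) m (p : {mpoly R[m]}) i j :
  (size (pencil_diag p i j) <= 2)%N.
Proof.
rewrite pencil_diagE (leq_trans (size_polyD _ _)) // geq_max.
rewrite (leq_trans (size_polyC_leq1 _)) //=.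
by rewrite (leq_trans (size_scale_leq _ _)) // size_polyX.
Qed.

Definition uni_det (R : rcfType) n : {poly R} :=
  \det (pencil_diag (eulerian_uni R n)).

Lemma uni_detE (R : rcfType) n :
  uni_det R n =
  ((uni_det R n)`_0)%:P + (uni_det R n)`_1 *: 'X + (uni_det R n)`_2 *: 'X^2.
Proof.
suff sz : (size (uni_det R n) <= 3)%N.
  rewrite -[LHS](take_poly_id sz) /take_poly poly_def !big_ord_recl big_ord0 /=.
  by rewrite addr0 addrA expr0 alg_polyC expr1.
have sE := size_pencil_diag (eulerian_uni R n).
have sM (q r : {poly R}) : (size q <= 2)%N -> (size r <= 2)%N ->
    (size (q * r)%R <= 3)%N.
  move=> q2 r2; apply: leq_trans (size_polyMleq _ _) _.
  by have := leq_add q2 r2; rewrite -ltnS; case: (_ + _)%N.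
rewrite /uni_det (expand_det_row _ ord0) (leq_trans (size_sum _ _ _)) //.
apply/bigmax_leqP => i _; rewrite /cofactor det_mx11 sM ?sE //.
move: (pencil_diag _) sE => M sE; rewrite -signr_odd mulr_sign.
by case: odd; rewrite ?size_polyN !mxE sE.
Qed.

Definition uni_bound (R : rcfType) n : R :=
  let c := (uni_det R n)`_0 in
  let b := (uni_det R n)`_1 in
  let a := (uni_det R n)`_2 in
  2 * a / (b - Num.sqrt (b ^+ 2 - 4 * a * c)).

Definition mult_vec (R : rcfType) n (y : R) : 'cV[R]_n.+2 :=
  \col_i match val i with 0%N => y | 1%N => 0 | 2%N => 1 | _ => -1 end.

(* v^T M_p(x, ..., x) v = D + x N, with v = (y, 0, 1, -1, ..., -1). *)
Definition mult_form (R : rcfType) n (y : R) : {poly R} :=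
  let v := map_mx (@polyC R) (mult_vec n y) in
  (v^T *m pencil_diag (eulerian_multi R n) *m v) 0 0.

Definition mult_D (R : rcfType) n (y : R) : R := (mult_form n y)`_0.
Definition mult_N (R : rcfType) n (y : R) : R := (mult_form n y)`_1.

Lemma mult_formE (R : rcfType) n (y : R) :
  mult_form n y = (mult_D n y)%:P + mult_N n y *: 'X.
Proof.
suff sz : (size (mult_form n y) <= 2)%N.
  rewrite -[LHS](take_poly_id sz) /take_poly poly_def !big_ord_recl big_ord0 /=.
  by rewrite addr0 expr0 alg_polyC expr1.
have sE := size_pencil_diag (eulerian_multi R n).
rewrite /mult_form; move: (pencil_diag _) sE => M sE.
rewrite mxE (leq_trans (size_sum _ _ _)) //.
apply/bigmax_leqP => j _; rewrite [X in _ * X]mxE mulrC mul_polyC.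
rewrite (leq_trans (size_scale_leq _ _)) // mxE (leq_trans (size_sum _ _ _)) //.
apply/bigmax_leqP => i _; rewrite !mxE mul_polyC.
by rewrite (leq_trans (size_scale_leq _ _)).
Qed.

(* A root bound only when mult_D and mult_N are both positive. *)
Definition mult_bound (R : rcfType) n (y : R) : R := mult_N n y / mult_D n y.

(* Main.v *)
From HB Require Import structures.
Require Import Defs.
From mathcomp Require Import all_boot all_order all_algebra all_fingroup.
From mathcomp Require Import ring lra.
From mathcomp.multinomials Require ssrcomplements mpoly.

(* On the d-th power of a linear form u.x, L_p takes the d-th power sum of the reciprocals of the
   negated roots of the univariate polynomial t |-> p(t u). Only the diagonal and x_2 matter here,
   so everything is read off the low order coefficients of
     A_n(z on x_2, w on x_3, ..., x_(n+1)) = A_n(w) + (z - w) A_(n-1)(w),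
   which follow from the recursion obtained by inserting the largest letter into a permutation.
   With T = 2^(n+1), S = 3^(n+1), k = n+2 the univariate power sums are
     m1 = T - k, m2 = T^2 - 2S + k, m3 = T^3 - 3TS + 3T^2 - k,
   and un is the largest root u of (m1 - u n)(m3 - u m2) - (m2 - u m1)^2; it lies just above m3/m2,
   whence u = T - (S/T)(1 + o(1)).
   Choosing for y the kernel vector of the univariate pencil at -1/u cancels the
   univariate part of N - u D, and what remains is 4S(1/6 + o(1)), while D ~ T^2. Hence
   N/D - u ~ (2/3) S/T^2 = (1/2)(3/4)^n. *)

Set Implicit Arguments.
Unset Strict Implicit.
Unset Printing Implicit Defensive.

Import Order.TTheory GRing.Theory Num.Theory.

(** * Descents of permutation words *)

Section DescentWords.
Local Open Scope nat_scope.

(** The default [x] of [head] keeps the last letter from being a descent top. *)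
Fixpoint ndesc (P : pred nat) (l : seq nat) : nat :=
  if l is x :: l' then (P x && (head x l' < x)) + ndesc P l' else 0.

Definition insert_at (i M : nat) (l : seq nat) : seq nat :=
  take i l ++ M :: drop i l.

Lemma insert_at_cons i M x l :
  insert_at i.+1 M (x :: l) = x :: insert_at i M l.
Proof. by []. Qed.

Lemma ndescE P l :
  ndesc P l = \sum_(i < (size l).-1) (P (nth 0 l i) && (nth 0 l i.+1 < nth 0 l i)).
Proof.
elim: l => [|x [|y l] IH] /=; first by rewrite big_ord0.
  by rewrite ltnn andbF big_ord0.
by rewrite big_ord_recl /=; congr (_ + _); exact: IH.
Qed.

Lemma ndesc_le_count P l : ndesc P l <= count P l.
Proof. by elim: l => //= x l IH; apply: leq_add => //; case: (P x) => //=; exact: leq_b1. Qed.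

(** A maximal letter put last changes nothing. Put inside a descent it replaces the old descent top:
    the counts stay if that top fails [P] ([b] places), and one unit moves from [a] to [b] if it
    satisfies [P] ([a] places). Put inside an ascent it adds one to [b]. The word [x :: l] has
    [size l] inner gaps. *)
Lemma sum_insert_interior (R : comPzRingType) (P : pred nat) M x l
    (F : nat -> nat -> R) :
  ~~ P M -> all (fun y => y < M) (x :: l) ->
  (\sum_(i < (size l).+1)
     F (ndesc P (x :: insert_at i M l)) (ndesc (predC P) (x :: insert_at i M l)) =
   let a := ndesc P (x :: l) in let b := ndesc (predC P) (x :: l) in
   (1 + b%:R) * F a b + a%:R * F a.-1 b.+1 +
   ((size l)%:R - a%:R - b%:R) * F a b.+1)%R.
Proof.
move=> PM; elim: l x F => [|y l IH] x F /=.
  rewrite big_ord_recl big_ord0 /= !ltnn !andbF !addn0 andbT => xM.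
  have -> : (M < x) = false by apply/negbTE; rewrite -leqNgt ltnW.
  by rewrite !andbF /=; ring.
move=> /and3P[xM yM lM]; rewrite big_ord_recl.
under eq_bigr => i _ do rewrite lift0 insert_at_cons.
rewrite /= (negbTE PM) /=.
have -> : (M < x) = false by apply/negbTE; rewrite -leqNgt ltnW.
rewrite !andbF yM /= !add0n !add1n.
pose dp : nat := P x && (y < x); pose dn : nat := ~~ P x && (y < x).
have := IH y (fun a b => F (dp + a) (dn + b)) _.
rewrite /= yM lM => /(_ isT).
rewrite /dp /dn => ->.
rewrite -/(ndesc P (y :: l)) -/(ndesc (predC P) (y :: l)).
move: (ndesc P (y :: l)) (ndesc (predC P) (y :: l)) => a b.
case: (P x); case: (y < x); rewrite /= ?add1n ?add0n ?addnS -?natr1;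
  case: a => [|a] /=; rewrite -?natr1; ring.
Qed.

(** For a nonempty word the place in front acts like an ascent, which accounts for the full length
    of the word in the last coefficient. *)
Lemma sum_insert_at (R : comPzRingType) (P : pred nat) M l (F : nat -> nat -> R) :
  ~~ P M -> all (fun y => y < M) l ->
  (\sum_(i < (size l).+1)
     F (ndesc P (insert_at i M l)) (ndesc (predC P) (insert_at i M l)) =
   let a := ndesc P l in let b := ndesc (predC P) l in
   (1 + b%:R) * F a b + a%:R * F a.-1 b.+1 +
   ((size l)%:R - a%:R - b%:R) * F a b.+1)%R.
Proof.
case: l => [|x l] PM lM.
  by rewrite big_ord_recl big_ord0 /= (negbTE PM) ltnn /=; ring.
rewrite big_ord_recl.
under eq_bigr => i _ do rewrite lift0 insert_at_cons.
rewrite (sum_insert_interior _ PM lM) /= (negbTE PM).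
have /andP[xM _] : (x < M) && all (fun y => y < M) l by [].
by rewrite xM /= add0n add1n -natr1; ring.
Qed.

Definition word n (s : 'S_n) : seq nat := [seq val (s i) | i <- enum 'I_n].

Lemma size_word n (s : 'S_n) : size (word s) = n.
Proof. by rewrite size_map size_enum_ord. Qed.

Lemma nth_word n (s : 'S_n) (i : 'I_n) : nth 0 (word s) i = s i.
Proof. by rewrite (nth_map i) ?size_enum_ord // nth_ord_enum. Qed.

Lemma word_lt n (s : 'S_n) : all (fun y => y < n) (word s).
Proof. by apply/allP => _ /mapP[i _ ->] /=. Qed.

Lemma word_uniq n (s : 'S_n) : uniq (word s).
Proof. by rewrite map_inj_uniq ?enum_uniq // => i j /val_inj/perm_inj. Qed.

Lemma word_lift_perm n (s : 'S_n) (i : 'I_n.+1) :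
  word (lift_perm i ord_max s) = insert_at i n (word s).
Proof.
have lei : i <= n by rewrite -ltnS.
have sz : size (insert_at i n (word s)) = n.+1.
  by rewrite size_cat /= addnS -size_cat cat_take_drop size_word.
apply: (@eq_from_nth _ 0) => [|k]; first by rewrite sz size_word.
rewrite size_word => kn; rewrite -[k]/(val (Ordinal kn)) nth_word.
case: (unliftP i (Ordinal kn)) => [j /[dup] E ->|->]; last first.
  by rewrite lift_perm_id nth_cat size_take_min size_word (minn_idPl lei) ltnn subnn.
rewrite lift_perm_lift /= /bump leqNgt ltn_ord add0n -[LHS]nth_word.
rewrite nth_cat size_take_min size_word (minn_idPl lei).
case: (leqP i j) => ij; rewrite ?add1n ?add0n; last by rewrite ij nth_take.
by rewrite ltnNge leqW //= subSn //= nth_drop subnKC.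
Qed.

(** Inserting the largest letter is injective on pairs of a permutation and a place, hence bijective
    because (n+1)! = (n+1) n!. *)
Lemma sum_word_recr (R : pzRingType) n (F : seq nat -> R) :
  (\sum_(s : 'S_n.+1) F (word s) =
   \sum_(s : 'S_n) \sum_(i < n.+1) F (insert_at i n (word s)))%R.
Proof.
rewrite pair_big /=.
rewrite (reindex (fun p : 'S_n * 'I_n.+1 => lift_perm p.2 ord_max p.1)) /=.
  by apply: eq_bigr => -[s i] _ /=; rewrite word_lift_perm.
apply: onW_bij; apply: inj_card_bij; last first.
  by rewrite card_prod card_Sn card_ord card_Sn factS mulnC.
move=> [s i] [t j] /= E.
have ij : i = j.
  by apply: (@perm_inj _ (lift_perm i ord_max s)); rewrite {2}E !lift_perm_id.
rewrite -ij in E *; congr (_, _); apply/permP => k; apply: (@lift_inj _ ord_max).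
by rewrite -!(lift_perm_lift i) E.
Qed.

End DescentWords.

(** * Joint distribution of the descent at the letter 2 and the other descents *)

Section DescentCounts.
Variable R : numFieldType.
Implicit Types (F : nat -> nat -> R) (n : nat).
Local Open Scope ring_scope.

(** Letters start at 0, so the letter 1 carries the variable x_2: [F] takes its descent indicator
    and the number of all other descent tops. *)
Definition desc_sum n F : R :=
  \sum_(s : 'S_n) F (ndesc (pred1 1%N) (word s)) (ndesc (predC (pred1 1%N)) (word s)).

Lemma ndesc1_le1 n (s : 'S_n) : (ndesc (pred1 1%N) (word s) <= 1)%N.
Proof.
by apply: leq_trans (ndesc_le_count _ _) _; rewrite count_uniq_mem ?word_uniq // leq_b1.
Qed.

Lemma eq_desc_sum n F F' :
  (forall a b, (a <= 1)%N -> F a b = F' a b) -> desc_sum n F = desc_sum n F'.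
Proof. by move=> FF'; apply: eq_bigr => s _; apply: FF'; exact: ndesc1_le1. Qed.

Lemma desc_sumD n F F' :
  desc_sum n (fun a b => F a b + F' a b) = desc_sum n F + desc_sum n F'.
Proof. exact: big_split. Qed.

Lemma desc_sumZ n c F : desc_sum n (fun a b => c * F a b) = c * desc_sum n F.
Proof. by rewrite /desc_sum mulr_sumr. Qed.

Lemma desc_sum2 F : desc_sum 2 F = F 0%N 0%N + F 1%N 0%N.
Proof.
pose G l := F (ndesc (pred1 1%N) l) (ndesc (predC (pred1 1%N)) l).
rewrite /desc_sum (sum_word_recr _ G).
rewrite (sum_word_recr _ (fun l => \sum_(i < 2) G (insert_at i 1 l))).
have word0 (s : 'S_0) : word s = [::] by apply: size0nil; rewrite size_word.
under eq_bigr => s _ do rewrite word0 big_ord_recl big_ord0 addr0.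
rewrite sumr_const card_Sn /= mulr1n !big_ord_recl big_ord0 addr0 addrC.
by congr (_ + _).
Qed.

(** The hypothesis keeps the inserted letter [n] apart from the letter 1; hence inductions start
    with two letters. *)
Lemma desc_sum_recr n F : (1 < n)%N ->
  desc_sum n.+1 F =
  desc_sum n (fun a b => (1 + b%:R) * F a b + a%:R * F a.-1 b.+1 +
                         (n%:R - a%:R - b%:R) * F a b.+1).
Proof.
move=> n1; pose G l := F (ndesc (pred1 1%N) l) (ndesc (predC (pred1 1%N)) l).
rewrite /desc_sum (sum_word_recr _ G); apply: eq_bigr => s _.
have := @sum_insert_at R (pred1 1%N) n (word s) F.
rewrite size_word word_lt; apply => //.
by rewrite /= neq_ltn n1 orbT.
Qed.

Definition desc_count n i j : R :=
  desc_sum n (fun a b => ((a == i) && (b == j))%:R).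

Lemma desc_count0_recr n j : (1 < n)%N ->
  desc_count n.+1 0 j.+1 =
  j.+2%:R * desc_count n 0 j.+1 + desc_count n 1 j + (n%:R - j%:R) * desc_count n 0 j.
Proof.
move=> n1; rewrite /desc_count desc_sum_recr // -!desc_sumZ -!desc_sumD.
apply: eq_desc_sum => -[|[|a]] b //= _; rewrite ?eqSS -?(natr1 j.+1).
  by case: eqP => [->|_]; [rewrite (gtn_eqF (ltnSn j)) | case: eqP => [->|_]];
    rewrite -?natr1 /=; ring.
by case: eqP => [->|_]; rewrite /=; ring.
Qed.

Lemma desc_count1_recr n j : (1 < n)%N ->
  desc_count n.+1 1 j.+1 =
  j.+2%:R * desc_count n 1 j.+1 + (n%:R - j.+1%:R) * desc_count n 1 j.
Proof.
move=> n1; rewrite /desc_count desc_sum_recr // -!desc_sumZ -!desc_sumD.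
apply: eq_desc_sum => -[|[|a]] b //= _; rewrite ?eqSS -?(natr1 j.+1) -?(natr1 j).
  by ring.
by case: eqP => [->|_]; [rewrite (gtn_eqF (ltnSn j)) | case: eqP => [->|_]];
    rewrite -?natr1 /=; ring.
Qed.

Lemma desc_count_0_recr n i : (1 < n)%N ->
  desc_count n.+1 i 0 = desc_count n i 0.
Proof.
move=> n1; rewrite /desc_count desc_sum_recr //.
apply: eq_desc_sum => a b _; rewrite !andbF.
by case: b => [|b]; rewrite /= ?andbF ?andbT /=; ring.
Qed.

(* [eul1 n], [eul2 n], [eul3 n] count the permutations of n letters with 1, 2, 3 descents. *)
Definition eul1 n : R := 2 ^+ n - n%:R - 1.
Definition eul2 n : R := 3 ^+ n - (n%:R + 1) * 2 ^+ n + n%:R * (n%:R + 1) / 2.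
Definition eul3 n : R :=
  4 ^+ n - (n%:R + 1) * 3 ^+ n + n%:R * (n%:R + 1) / 2 * 2 ^+ n -
  n%:R * (n%:R + 1) * (n%:R - 1) / 6.

(** The letter 1 is a descent top exactly when 0 follows it, and merging these two letters leaves a
    permutation of one letter fewer with the other descents intact. So the counts with first index 1
    are Eulerian numbers for [n.+1], and those with first index 0 are differences of Eulerian
    numbers. The recursions confirm this by induction. *)
Lemma desc_countE n :
  [/\ desc_count n.+2 0 0 = 1, desc_count n.+2 1 0 = 1,
      desc_count n.+2 1 1 = eul1 n.+1 & desc_count n.+2 1 2 = eul2 n.+1] /\
  [/\ desc_count n.+2 0 1 = eul1 n.+2 - 1,
      desc_count n.+2 0 2 = eul2 n.+2 - eul1 n.+1 &
      desc_count n.+2 0 3 = eul3 n.+2 - eul2 n.+1].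
Proof.
elim: n => [|n [[h00 h10 h11 h12] [h01 h02 h03]]].
  rewrite /desc_count !desc_sum2 /= /eul1 /eul2 /eul3.
  by split; split; field.
rewrite !(@desc_count_0_recr n.+2, @desc_count0_recr n.+2, @desc_count1_recr n.+2) //.
rewrite h00 h10 h11 h12 h01 h02 h03 /eul1 /eul2 /eul3 !exprS -!natr1.
by split; split; field.
Qed.

Lemma desc_sum_weight n (z w : R) :
  let e d := desc_sum n.+2 (fun a b => z ^+ a * w ^+ b * ((a + b)%N == d)%:R) in
  [/\ e 0%N = 1, e 1%N = z + w * (eul1 n.+2 - 1),
      e 2%N = z * w * eul1 n.+1 + w ^+ 2 * (eul2 n.+2 - eul1 n.+1) &
      e 3%N = z * w ^+ 2 * eul2 n.+1 + w ^+ 3 * (eul3 n.+2 - eul2 n.+1)].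
Proof.
have [[h00 h10 h11 h12] [h01 h02 h03]] := desc_countE n.
have e d : desc_sum n.+2 (fun a b => z ^+ a * w ^+ b * ((a + b)%N == d.+1)%:R) =
    z * w ^+ d * desc_count n.+2 1 d + w ^+ d.+1 * desc_count n.+2 0 d.+1.
  rewrite /desc_count -!desc_sumZ -desc_sumD; apply: eq_desc_sum => -[|[|a]] b //= _.
    by rewrite ?add0n; case: eqP => [->|_] /=; ring.
  by rewrite ?add1n ?eqSS; case: eqP => [->|_] /=; ring.
split; rewrite ?e ?h10 ?h11 ?h12 ?h01 ?h02 ?h03; try by ring.
rewrite /=; apply: etrans h00; apply: eq_desc_sum => -[|a] [|b] _.
all: by rewrite /= ?addn0 ?addnS /=; ring.
Qed.

End DescentCounts.

(** * The linear form on powers of linear forms *)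

(* A module, so that the notations of mpoly, which clash with those of mathcomp-analysis,
   are not in force below. *)
Module Pencil.
Import ssrcomplements mpoly.

Section Multinomial.
Variables (R : rcfType) (m : nat).
Implicit Types (p q : {mpoly R[m]}) (u : 'I_m -> R) (a b : 'X_{1..m}).
Local Open Scope ring_scope.

Definition lin u : {mpoly R[m]} := \sum_i u i *: 'X_i.

Definition line u p : {poly R} := mmap (@polyC R) (fun i => (u i)%:P * 'X) p.

Lemma coef_line u p K d : (msize p <= K)%N ->
  (line u p)`_d = \sum_(a : 'X_{1..m < K} | mdeg a == d) p@_a * \prod_i u i ^+ a i.
Proof.
move=> pK; rewrite /line (mmapE K) // coef_sum [RHS]big_mkcond /=.
apply: eq_bigr => a _; rewrite /mmap1.
have E : \prod_(i < m) ((u i)%:P * 'X) ^+ bmnm a i =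
    (\prod_(i < m) u i ^+ bmnm a i)%:P * 'X^(mdeg a) :> {poly R}.
  rewrite rmorph_prod mdegE -prodrXr -big_split /=; apply: eq_bigr => i _.
  by rewrite exprMn polyC_exp.
rewrite [X in _ * X]E !mul_polyC !coefZ coefXn eq_sym.
by case: eqP => _; rewrite ?mulr1 ?mulr0.
Qed.

Lemma multinomial_coef_add1 b i :
  (mdeg b).+1%:R * multinomial_coef R b =
  (b i).+1%:R * multinomial_coef R (b + U_(i))%MM.
Proof.
rewrite /multinomial_coef mdegD mdeg1 addn1 factS.
have -> : (\prod_(j < m) ((b + U_(i))%MM j)`! = (b i).+1 * \prod_(j < m) (b j)`!)%N.
  rewrite (bigD1 i) //= [in RHS](bigD1 i) //= mnmDE mnm1E eqxx addn1 factS -mulnA.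
  congr (_ * (_ * _))%N; apply: eq_bigr => j ji.
  by rewrite mnmDE mnm1E eq_sym (negPf ji) addn0.
have h : (\prod_(j < m) (b j)`!)%:R != 0 :> R.
  by rewrite pnatr_eq0 -lt0n prodn_gt0 // => j; apply: fact_gt0.
rewrite !natrM; field; rewrite h /=.
by rewrite addrC natr1 pnatr_eq0.
Qed.

Lemma mcoeffXUM i q a :
  ('X_i * q)@_a = if a i == 0%N then 0 else q@_(a - U_(i))%MM.
Proof.
case: eqP => [ai|/eqP ai].
  rewrite mcoeffM big1 // => -[b c] /= /eqP E.
  rewrite mcoeffX; case: eqP => [bE|_]; last by rewrite mul0r.
  by move: ai; move/(congr1 (fun x : 'X_{1..m} => x i)): E; rewrite -bE mnmDE mnm1E eqxx => ->.
have E : a = (U_(i) + (a - U_(i)))%MM by rewrite addmC submK // lep1mP.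
by rewrite {1}E mulrC mcoeffMX.
Qed.

Lemma mcoeff_lin_exp u d a :
  (lin u ^+ d)@_a =
  (mdeg a == d)%:R * (multinomial_coef R a * \prod_i u i ^+ a i).
Proof.
elim: d a => [|d IH] a.
  rewrite expr0 mcoeff1 mdeg_eq0; case: eqP => [->|_]; last by rewrite mul0r.
  rewrite /multinomial_coef mdeg0 !big1 ?mulr1 ?divr1 ?mul1r // => i _.
  - by rewrite mnm0E expr0.
  - by rewrite mnm0E.
rewrite exprS /lin mulr_suml raddf_sum /=.
(* The factor u_i x_i supplies the share a_i / (d+1) of the multinomial coefficient, and the a_i add
   up to d+1. *)
have step i : ((u i *: 'X_i) * lin u ^+ d)@_a =
   (a i)%:R * ((d.+1)%:R^-1 * (mdeg a == d.+1)%:R *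
     (multinomial_coef R a * \prod_j u j ^+ a j)).
  rewrite -scalerAl mcoeffZ mcoeffXUM; case: eqP => [->|/eqP ai].
    by rewrite mulr0 mul0r.
  have [b E] : exists b, a = (b + U_(i))%MM.
    by exists (a - U_(i))%MM; rewrite submK // lep1mP.
  rewrite E addmK IH mdegD mdeg1 addn1 eqSS; case: eqP => [<-|_]; last by rewrite !(mul0r,mulr0).
  rewrite mnmDE mnm1E eqxx addn1 !mul1r mulr1.
  rewrite (mulrCA (b i).+1%:R) (mulrA (b i).+1%:R) -multinomial_coef_add1.
  have -> : \prod_j u j ^+ (b + U_(i))%MM j = u i * \prod_j u j ^+ b j.
    rewrite (bigD1 i) //= [in RHS](bigD1 i) //= mnmDE mnm1E eqxx addn1 exprS -mulrA.
    congr (_ * (_ * _)); apply: eq_bigr => j ji.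
    by rewrite mnmDE mnm1E eq_sym (negPf ji) addn0.
  by rewrite -[X in _ = _ * X]mulrA mulKf ?pnatr_eq0 // mulrCA.
under eq_bigr => i _ do rewrite step.
rewrite -mulr_suml -natr_sum -mdegE; case: eqP => [->|_]; last by rewrite !(mulr0, mul0r).
by rewrite mulr1 mul1r mulrA mulfV ?pnatr_eq0 // mul1r.
Qed.

Lemma Lform_bounded p q K : (msize q <= K)%N ->
  Lform p q = \sum_(a : 'X_{1..m < K}) q@_a * Lform_monomial p a.
Proof.
move=> qK; rewrite /Lform (big_mksub 'X_{1..m < K}) /=; first last.
- by move=> x /msize_mdeg_lt /leq_trans; apply.
- exact: msupp_uniq.
rewrite big_rmcond //= => i; rewrite mcoeff_msupp negbK => /eqP ->.
by rewrite mul0r.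
Qed.

Lemma line_normalized_opp u p : p.@[fun=> 0] = 1 ->
  line u (normalized_opp p) = line u p \Po - 'X.
Proof.
move=> p0; rewrite /normalized_opp p0 invr1 scale1r.
have -> : p \mPo [tuple - 'X_i | i < m] =
   \sum_(a <- msupp p) p@_a *: \prod_(i < m) (- 'X_i) ^+ a i.
  rewrite comp_mpolyEX; apply: eq_bigr => a _; rewrite comp_mpolyX.
  by congr (_ *: _); apply: eq_bigr => i _; rewrite tnth_mktuple.
rewrite /line raddf_sum /= [mmap _ _ p]/mmap raddf_sum /=; apply: eq_bigr => a _.
rewrite mmapZ rmorphM /= comp_polyC; congr (_ * _).
rewrite /mmap1 !rmorph_prod /=; apply: eq_bigr => i _.
rewrite !rmorphXn /= rmorphN /= mmapX mmap1U rmorphM /= comp_polyC comp_polyX.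
by rewrite mulrN.
Qed.

(** The multinomial coefficients of the d-th power cancel those in the denominators of L_p(x^a).
    What remains is -d times the coefficient of t^d in the logarithm of p(-t u), a univariate
    quantity. *)
Lemma Lform_lin_exp u p d : p.@[fun=> 0] = 1 -> (0 < d)%N ->
  Lform p (lin u ^+ d) =
  - d%:R * \sum_(1 <= k < d.+1)
     (-1) ^+ k.+1 / k%:R * ((line u p \Po - 'X - 1) ^+ k)`_d.
Proof.
move=> p0 d0; set f := normalized_opp p.
pose K := maxn (msize (lin u ^+ d)) (\max_(k < d.+1) msize ((f - 1) ^+ k)).
rewrite (Lform_bounded _ (leq_maxl _ _ : (_ <= K)%N)).
have -> : \sum_(a : 'X_{1..m < K}) (lin u ^+ d)@_a * Lform_monomial p a =
   \sum_(a : 'X_{1..m < K} | mdeg a == d)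
      - d%:R * (log_coef f a * \prod_i u i ^+ a i).
  rewrite [RHS]big_mkcond /=; apply: eq_bigr => a _; rewrite mcoeff_lin_exp.
  case: eqP => [ad|_]; last by rewrite !mul0r.
  have a0 : bmnm a == 0%MM = false by rewrite -mdeg_eq0 ad eqn0Ngt d0.
  rewrite /Lform_monomial a0 -/f ad mul1r.
  have c0 : multinomial_coef R a != 0.
    rewrite mulf_neq0 ?invr_eq0 ?pnatr_eq0 -?lt0n ?fact_gt0 // prodn_gt0 // => i.
    exact: fact_gt0.
  by field.
rewrite -mulr_sumr; congr (_ * _).
under eq_bigr => a /eqP ad do rewrite /log_coef ad mulr_suml.
rewrite exchange_big /= big_nat [RHS]big_nat; apply: eq_bigr => k /andP[_ kd].
have kK : (msize ((f - 1) ^+ k) <= K)%N.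
  by apply: leq_trans (leq_maxr _ _); apply: (leq_bigmax (Ordinal kd)).
transitivity (\sum_(a : 'X_{1..m < K} | mdeg a == d)
    ((-1) ^+ k.+1 / k%:R) * (((f - 1) ^+ k)@_a * \prod_i u i ^+ a i)).
  by apply: eq_bigr => a _; rewrite [RHS]mulrA.
rewrite -mulr_sumr -(coef_line u d kK); congr (_ * (_)`_d).
by rewrite /line rmorphXn /= rmorphB /= rmorph1 -line_normalized_opp.
Qed.

End Multinomial.

(** * Newton's identities, polarization and the quadratic form of a pencil *)

Section PowerSums.
Variables (R : rcfType) (m : nat).
Implicit Types (p q : {mpoly R[m]}) (u v : 'I_m -> R).
Local Open Scope ring_scope.

Lemma line_coef0 u p : (line u p)`_0 = p.@[fun=> 0].
Proof.
rewrite -horner_coef0 /line /meval /mmap horner_sum; apply: eq_bigr => a _.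
rewrite hornerM hornerC /mmap1 horner_prod; congr (_ * _).
by apply: eq_bigr => i _; rewrite horner_exp hornerM hornerX mulr0.
Qed.

Lemma coef_comp_polyNX (q : {poly R}) d : (q \Po - 'X)`_d = (-1) ^+ d * q`_d.
Proof.
have E k : (- 'X) ^+ k = ((-1) ^+ k)%:P * 'X^k :> {poly R}.
  by rewrite [LHS]exprNn polyC_exp polyCN.
rewrite comp_polyE coef_sum.
have [dq|qd] := ltnP d (size q); last first.
  rewrite [X in _ = _ * X]nth_default // mulr0 big1 // => i _.
  rewrite E coefZ coefCM coefXn.
  by rewrite gtn_eqF ?mulr0 // (leq_trans (ltn_ord i)).
rewrite (bigD1 (Ordinal dq)) //= big1 ?addr0 => [|i /eqP id].
  by rewrite E coefZ coefCM coefXn eqxx mulr1 mulrC.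
rewrite E coefZ coefCM coefXn.
by case: eqP => [di|_]; rewrite ?mulr0 //; case: id; apply: val_inj.
Qed.

(* Newton's identities: on powers of linear forms, L_p takes the power sums of the
   reciprocals of the negated roots of the univariate polynomial p(t u). *)
Lemma Lform_lin u p : p.@[fun=> 0] = 1 ->
  let e d := (line u p)`_d in
  [/\ Lform p (lin u) = e 1%N, Lform p (lin u ^+ 2) = e 1%N ^+ 2 - 2 * e 2%N &
      Lform p (lin u ^+ 3) = e 1%N ^+ 3 - 3 * e 1%N * e 2%N + 3 * e 3%N].
Proof.
move=> p0 /=; rewrite -[lin u in X in [/\ X, _ & _]]expr1 !Lform_lin_exp //.
rewrite /index_iota /= !big_cons !big_nil.
rewrite !exprS expr0 !mulr1 !coefM !big_ord_recl !big_ord0 /=.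
rewrite !coefM !big_ord_recl !big_ord0 /=.
rewrite !coefB !coef1 !coef_comp_polyNX line_coef0 p0 /=.
by split; field.
Qed.

HB.instance Definition _ p :=
  GRing.isLinear.Build R {mpoly R[m]} R _ (Lform p) (Lform_linear p).

Lemma linD u v : lin (fun i => u i + v i) = lin u + lin v.
Proof. by rewrite /lin -big_split; apply: eq_bigr => i _; rewrite scalerDl. Qed.

Lemma linB u v : lin (fun i => u i - v i) = lin u - lin v.
Proof. by rewrite /lin -sumrB; apply: eq_bigr => i _; rewrite scalerBl. Qed.

(** Polarization reduces mixed products to the powers on which [Lform] is known. *)
Lemma Lform_lin_polar2 u v p :
  Lform p (lin u * lin v) =
  (Lform p (lin (fun i => u i + v i) ^+ 2) - Lform p (lin (fun i => u i - v i) ^+ 2)) / 4.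
Proof.
rewrite linD linB -raddfB /=.
have -> : (lin u + lin v) ^+ 2 - (lin u - lin v) ^+ 2 = (lin u * lin v) *+ 4 by ring.
by rewrite raddfMn /=; field.
Qed.

Lemma Lform_lin_polar3 u v p :
  Lform p (lin u * lin v ^+ 2) =
  (Lform p (lin (fun i => u i + v i) ^+ 3) + Lform p (lin (fun i => u i - v i) ^+ 3)
   - 2 * Lform p (lin u ^+ 3)) / 6.
Proof.
rewrite linD linB mulr_natl -raddfMn -raddfD -raddfB /=.
have -> : (lin u + lin v) ^+ 3 + (lin u - lin v) ^+ 3 - lin u ^+ 3 *+ 2 =
          (lin u * lin v ^+ 2) *+ 6 by ring.
by rewrite raddfMn /=; field.
Qed.

Lemma quadratic_form_affine k (M : 'M[{poly R}]_k) (a b : 'I_k -> 'I_k -> R)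
    (v : 'cV[R]_k) :
  (forall i j, M i j = (a i j)%:P + b i j *: 'X) ->
  ((map_mx (@polyC R) v)^T *m M *m map_mx (@polyC R) v) 0 0 =
  (\sum_j \sum_i v i 0 * v j 0 * a i j)%:P +
  (\sum_j \sum_i v i 0 * v j 0 * b i j) *: 'X.
Proof.
move=> ME; rewrite raddf_sum /= scaler_suml -big_split mxE /=.
apply: eq_bigr => j _; rewrite !mxE mulr_suml raddf_sum scaler_suml -big_split /=.
apply: eq_bigr => i _; rewrite !mxE ME -!mul_polyC !polyCM; ring.
Qed.

(** Since Q has rank one, v^T Q v is the square of q = y + u.x. Setting all pencil variables equal
    multiplies it by the sum of the x_i in the linear part. *)
Lemma pencil_quadratic_form (v : 'cV[R]_m.+1) p :
  let u i := v (lift ord0 i) 0 in let y := v ord0 0 in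
  ((map_mx (@polyC R) v)^T *m pencil_diag p *m map_mx (@polyC R) v) 0 0 =
  (y ^+ 2 * Lform p 1 + 2 * y * Lform p (lin u) + Lform p (lin u ^+ 2))%:P +
  (y ^+ 2 * Lform p (lin (fun=> 1)) + 2 * y * Lform p (lin (fun=> 1) * lin u) +
   Lform p (lin (fun=> 1) * lin u ^+ 2)) *: 'X.
Proof.
move=> u y; pose r := monomial_row R m.
pose q := \sum_i v i 0 *: r 0 i.
have qE : q = y *: 1 + lin u.
  rewrite /q big_ord_recl /r mxE unlift_none; congr (_ + _).
  by apply: eq_bigr => i _; rewrite mxE liftK.
have Q i j : Qmx R m i j = r 0 i * r 0 j by rewrite mxE big_ord1 mxE.
have form (t : {mpoly R[m]}) :
    \sum_j \sum_i v i 0 * v j 0 * Lform p (t * Qmx R m i j) = Lform p (t * q ^+ 2).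
  rewrite expr2 [in X in q * X]/q mulr_sumr mulr_sumr raddf_sum /=.
  apply: eq_bigr => j _; rewrite {1}/q mulr_suml mulr_sumr raddf_sum /=.
  apply: eq_bigr => i _; rewrite Q -scalerAr -scalerAl -!scalerAr !linearZ /=.
  by ring.
have s1 : lin (fun=> 1) = \sum_(i < m) 'X_i :> {mpoly R[m]}.
  by apply: eq_bigr => i _; rewrite scale1r.
transitivity ((Lform p (q ^+ 2))%:P + Lform p (lin (fun=> 1) * q ^+ 2) *: 'X).
  rewrite -form -[q ^+ 2]mul1r -form (quadratic_form_affine _ (pencil_diagE p)).
  congr ((_)%:P + _ *: 'X); apply: eq_bigr => j _; apply: eq_bigr => i _.
    by rewrite mul1r.
  by rewrite s1 mulr_suml raddf_sum.
have q2 : q ^+ 2 = y ^+ 2 *: 1 + (2 * y) *: lin u + lin u ^+ 2.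
  by rewrite qE -!mul_mpolyC !mpolyCM -[2]/(2%:R) mpolyC_nat; ring.
rewrite q2 !mulrDr -!scalerAr mulr1 !raddfD /=.
by rewrite !linearZ /=.
Qed.

End PowerSums.

(** * Pencils of the Eulerian polynomials *)

Section Eulerian.
Variable R : rcfType.
Local Open Scope ring_scope.

Lemma ndesc_word P n (s : 'S_n.+1) :
  ndesc P (word s) = (\sum_(i < n) (P (s (widen_ord (leqnSn n) i)) && is_descent s i))%N.
Proof.
rewrite ndescE size_word; apply: eq_bigr => i _.
rewrite -(nth_word s (widen_ord (leqnSn n) i)) /is_descent.
by rewrite -[in RHS](nth_word s (lift ord0 i)) -(nth_word s (widen_ord (leqnSn n) i)).
Qed.

Lemma desE n (s : 'S_n.+1) : des s = #|descent_tops s|.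
Proof.
rewrite /descent_tops /des card_imset => [|i j /perm_inj /(congr1 val) /= ij].
  by apply: eq_card => i; rewrite inE.
exact: val_inj.
Qed.

(** The smallest letter is never a descent top, so the values of [F] at the letters from 1 on
    determine the product. *)
Lemma prod_descent_tops (A : comPzRingType) n (s : 'S_n.+1) (F : 'I_n.+1 -> A) (z w : A) :
  (forall i, val i = 1%N -> F i = z) -> (forall i, (1 < val i)%N -> F i = w) ->
  \prod_(k in descent_tops s) F k =
  z ^+ ndesc (pred1 1%N) (word s) * w ^+ ndesc (predC (pred1 1%N)) (word s).
Proof.
move=> Fz Fw; rewrite big_imset /=; last first.
  by move=> i j _ _ /perm_inj /(congr1 val) /= ij; apply: val_inj.
rewrite !ndesc_word -!prodrXr -big_split big_mkcond /=; apply: eq_bigr => i _.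
rewrite inE; case: ifP => di; last by rewrite !andbF !expr0 mulr1.
rewrite !andbT; case: eqP => [k1|/eqP k1]; rewrite ?expr1 ?expr0 ?mulr1 ?mul1r.
  by rewrite Fz.
rewrite Fw // ltn_neqAle eq_sym k1 (leq_ltn_trans _ (di : (_ < _)%N)) //.
Qed.

Lemma coef_line_eulerian n (u : 'I_n.+1 -> R) z w d :
  (forall i, val i = 1%N -> u i = z) -> (forall i, (1 < val i)%N -> u i = w) ->
  (line u (eulerian_multi R n))`_d =
  desc_sum n.+1 (fun a b => z ^+ a * w ^+ b * ((a + b)%N == d)%:R).
Proof.
move=> uz uw; rewrite /line /eulerian_multi raddf_sum coef_sum; apply: eq_bigr => s _.
rewrite /= (rmorph_prod (mmap (@polyC R) _)) /=.
rewrite (@prod_descent_tops _ _ _ _ (z%:P * 'X) (w%:P * 'X)).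
- rewrite !exprMn -!polyC_exp mulrACA -polyCM -exprD coefCM coefXn eq_sym.
  by congr (_ * _).
- by move=> i /uz <-; rewrite mmapX mmap1U.
- by move=> i /uw <-; rewrite mmapX mmap1U.
Qed.

(** Coefficients are natural numbers, so the monomial of largest degree cannot cancel. With the
    decreasing permutation as [s0] this yields the degree, that is L_p(1). *)
Lemma msize_sum_monomials (T : finType) m (M : T -> 'X_{1..m}) s0 :
  (forall s, (mdeg (M s) <= mdeg (M s0))%N) ->
  msize (\sum_s 'X_[M s] : {mpoly R[m]}) = (mdeg (M s0)).+1.
Proof.
move=> Mle; apply/eqP; rewrite eqn_leq; apply/andP; split.
  apply: leq_trans (mmeasure_sum _ _ _ _) _; apply/bigmax_leqP => s _.
  by rewrite msizeX ltnS.
apply: msize_mdeg_lt; rewrite mcoeff_msupp raddf_sum /=.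
under eq_bigr => s _ do rewrite mcoeffX.
by rewrite -natr_sum pnatr_eq0 (bigD1 s0) //= eqxx.
Qed.

Lemma des_le n (s : 'S_n.+1) : (des s <= n)%N.
Proof. by rewrite /des (leq_trans (max_card _)) ?card_ord. Qed.

Lemma des_rev n : des (perm (@rev_ord_inj n.+1)) = n.
Proof.
rewrite /des -[RHS](card_ord n); apply: eq_card => i.
rewrite inE /is_descent !permE /= /bump leq0n !subSS inE add1n.
by rewrite ltn_sub2l.
Qed.

Lemma msize_eulerian_multi n : msize (eulerian_multi R n) = n.+1.
Proof.
rewrite /eulerian_multi.
under eq_bigr => s _ do rewrite -(big_morph _ (@mpolyXD _ R) (@mpolyX0 _ R)).
have dM (s : 'S_n.+1) : mdeg (\sum_(k in descent_tops s) U_(k))%MM = des s.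
  rewrite mdeg_sum desE -sum1_card; apply: eq_bigr => k _; exact: mdeg1.
rewrite (msize_sum_monomials (s0 := perm (@rev_ord_inj n.+1))) dM des_rev // => s.
by rewrite dM des_le.
Qed.

Lemma msize_eulerian_uni n : msize (eulerian_uni R n) = n.+1.
Proof.
rewrite eulerian_uniE.
under eq_bigr => s _ do rewrite mpolyXn.
have dM (s : 'S_n.+1) : mdeg (U_(ord0 : 'I_1) *+ des s)%MM = des s.
  by rewrite mdegMn mdeg1 mul1n.
rewrite (msize_sum_monomials (s0 := perm (@rev_ord_inj n.+1))) dM des_rev // => s.
by rewrite dM des_le.
Qed.

Lemma line_eulerian_uni n :
  line (fun=> 1) (eulerian_uni R n) = line (fun=> 1) (eulerian_multi R n).
Proof.
rewrite /line eulerian_uniE /eulerian_multi !raddf_sum; apply: eq_bigr => s _.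
rewrite /= (rmorphXn (mmap (@polyC R) _)) (rmorph_prod (mmap (@polyC R) _)) /= mmapX mmap1U.
under [RHS]eq_bigr => k _ do rewrite mmapX mmap1U.
by rewrite prodr_const desE.
Qed.

Lemma eulerian_multi_at0 n : (eulerian_multi R n.+1).@[fun=> 0] = 1.
Proof.
rewrite -(line_coef0 (fun=> 1)) (@coef_line_eulerian _ _ 1 1) //.
by have [] := desc_sum_weight n (1 : R) 1.
Qed.

Lemma eulerian_uni_at0 n : (eulerian_uni R n.+1).@[fun=> 0] = 1.
Proof. by rewrite -(line_coef0 (fun=> 1)) line_eulerian_uni line_coef0 eulerian_multi_at0. Qed.

Lemma Lform_eulerian n (u : 'I_n.+2 -> R) (z w : R) :
  (forall i, val i = 1%N -> u i = z) -> (forall i, (1 < val i)%N -> u i = w) ->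
  let L := Lform (eulerian_multi R n.+1) in
  let e1 := z + w * (eul1 R n.+2 - 1) in
  let e2 := z * w * eul1 R n.+1 + w ^+ 2 * (eul2 R n.+2 - eul1 R n.+1) in
  let e3 := z * w ^+ 2 * eul2 R n.+1 + w ^+ 3 * (eul3 R n.+2 - eul2 R n.+1) in
  [/\ L (lin u) = e1, L (lin u ^+ 2) = e1 ^+ 2 - 2 * e2 &
      L (lin u ^+ 3) = e1 ^+ 3 - 3 * e1 * e2 + 3 * e3].
Proof.
move=> uz uw /=; have [-> -> ->] := Lform_lin u (eulerian_multi_at0 n).
rewrite !(coef_line_eulerian _ uz uw).
by have [_ -> -> ->] := desc_sum_weight n z w.
Qed.

(* Power sums of the reciprocals of the negated roots of the univariate Eulerian polynomial. *)
Definition ps1 n : R := 2 ^+ n.+1 - n.+2%:R.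
Definition ps2 n : R := (2 ^+ n.+1) ^+ 2 - 2 * 3 ^+ n.+1 + n.+2%:R.
Definition ps3 n : R :=
  (2 ^+ n.+1) ^+ 3 - 3 * 2 ^+ n.+1 * 3 ^+ n.+1 + 3 * (2 ^+ n.+1) ^+ 2 - n.+2%:R.

Lemma exp4 n : 4 ^+ n = (2 ^+ n) ^+ 2 :> R.
Proof. by rewrite exprAC; congr (_ ^+ _); ring. Qed.

Lemma Lform_eulerian_diag n :
  let L := Lform (eulerian_multi R n.+1) in
  [/\ L (lin (fun=> 1)) = ps1 n.+1, L (lin (fun=> 1) ^+ 2) = ps2 n.+1 &
      L (lin (fun=> 1) ^+ 3) = ps3 n.+1].
Proof.
move=> /=; have [//|//|-> -> ->] := @Lform_eulerian n (fun=> 1) 1 1.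
rewrite /ps1 /ps2 /ps3 /eul1 /eul2 /eul3 exp4 !(exprS _ n.+1) -!natr1.
by split; field.
Qed.

Lemma Lform_eulerian_uni n :
  let L := Lform (eulerian_uni R n.+1) in
  [/\ L 'X_ord0 = ps1 n.+1, L ('X_ord0 ^+ 2) = ps2 n.+1 & L ('X_ord0 ^+ 3) = ps3 n.+1].
Proof.
move=> /=; have <- : lin (fun=> 1) = 'X_ord0 :> {mpoly R[1]} by rewrite /lin big_ord1 scale1r.
have [<- <- <-] := Lform_eulerian_diag n.
have [-> -> ->] := Lform_lin (fun=> 1) (eulerian_uni_at0 n).
have [-> -> ->] := Lform_lin (fun=> 1) (eulerian_multi_at0 n).
by rewrite line_eulerian_uni.
Qed.

(** The pencil has rows (d + m1 x, m1 + m2 x) and (m1 + m2 x, m2 + m3 x), where d is the degree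
    [n.+1]. *)
Lemma uni_det_coefs n :
  [/\ (uni_det R n.+1)`_0 = n.+1%:R * ps2 n.+1 - ps1 n.+1 ^+ 2,
      (uni_det R n.+1)`_1 = n.+1%:R * ps3 n.+1 - ps1 n.+1 * ps2 n.+1 &
      (uni_det R n.+1)`_2 = ps1 n.+1 * ps3 n.+1 - ps2 n.+1 ^+ 2].
Proof.
have [L1 L2 L3] := Lform_eulerian_uni n.
move: (pencil_diagE (eulerian_uni R n.+1)).
rewrite /uni_det; move: (pencil_diag _) => M ME0.
have ME : forall i j, M i j = (Lform (eulerian_uni R n.+1) (Qmx R 1 i j))%:P +
    (Lform (eulerian_uni R n.+1) ('X_ord0 * Qmx R 1 i j)) *: 'X.
  by move=> i j; rewrite ME0 big_ord1.
have Q i j : Qmx R 1 i j = monomial_row R 1 0 i * monomial_row R 1 0 j.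
  by rewrite mxE big_ord1 mxE.
have r0 : monomial_row R 1 0 ord0 = 1 by rewrite mxE unlift_none.
have r1 : monomial_row R 1 0 (lift ord0 ord0) = 'X_ord0 by rewrite mxE liftK.
have L0 : Lform (eulerian_uni R n.+1) 1 = n.+1%:R by rewrite Lform1 msize_eulerian_uni.
have -> : \det M =
   (n.+1%:R * ps2 n.+1 - ps1 n.+1 ^+ 2)%:P +
   (n.+1%:R * ps3 n.+1 - ps1 n.+1 * ps2 n.+1)%:P * 'X +
   (ps1 n.+1 * ps3 n.+1 - ps2 n.+1 ^+ 2)%:P * 'X^2.
  rewrite (expand_det_row _ ord0) !big_ord_recl big_ord0 /cofactor !det_mx11.
  have -> : row' ord0 (col' ord0 M) 0 0 = M (lift ord0 ord0) (lift ord0 ord0).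
    by rewrite !mxE.
  have -> : row' ord0 (col' (lift ord0 ord0) M) 0 0 = M (lift ord0 ord0) ord0.
    by rewrite 2![LHS]mxE; congr (M _ _); apply: val_inj.
  rewrite !ME !Q r0 r1 !mulr1 mul1r -expr2 -exprS L0 L1 L2 L3.
  move: (ps1 _) (ps2 _) (ps3 _) => a b c.
  rewrite /= /bump /= -!mul_polyC !expr2 !polyCB !polyCM; ring.
move: (ps1 _) (ps2 _) (ps3 _) => a b c.
by split; rewrite !coefD !coefC !coefCM coefX coefXn /=; ring.
Qed.

(** Up to x_1, which does not occur in p, the vector stands for y + 2 x_2 - s, where s is the sum of
    the variables. Besides the power sums this involves L_p(x_2) = L_p(x_2^2) = 1, g = L_p(x_2 s) =
    L_p(x_2^2 s) and h = L_p(x_2 s^2). *)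
Lemma mult_form_coefs n (y : R) :
  let g := 2 ^+ n.+1 - 1 in
  let h := ps1 n.+1 * g - (2 * 3 ^+ n.+1 - (n.+1%:R + 3) * 2 ^+ n.+1 + (n.+1%:R + 1)) in
  mult_D n.+1 y = n.+1%:R * y ^+ 2 + 2 * y * (2 - ps1 n.+1) + ps2 n.+1 + 4 - 4 * g /\
  mult_N n.+1 y = ps1 n.+1 * y ^+ 2 + 2 * y * (2 * g - ps2 n.+1) + ps3 n.+1 + 4 * g - 4 * h.
Proof.
move=> g h; rewrite /mult_D /mult_N /mult_form pencil_quadratic_form.
set u := fun i => mult_vec _ _ _ _.
have u1 (i : 'I_n.+2) : val i = 1%N -> u i = 1.
  move=> i1; rewrite /u mxE -[val (lift _ _)]/(nat_of_ord (lift _ _)) lift0.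
  by rewrite -[nat_of_ord i]/(val i) i1.
have u2 (i : 'I_n.+2) : (1 < val i)%N -> u i = -1.
  rewrite /u mxE -[val (lift _ _)]/(nat_of_ord (lift _ _)) lift0 /=.
  by case: (nat_of_ord i) => [|[]].
have -> : mult_vec n.+1 y ord0 0 = y by rewrite mxE.
rewrite Lform1 msize_eulerian_multi /= Lform_lin_polar2 Lform_lin_polar3.
have [-> _ ->] := Lform_eulerian_diag n.
have [-> -> _] := Lform_eulerian u1 u2.
(* Adding [u] to the diagonal kills every variable after x_2 and subtracting it kills x_2, so both
   polarized forms again have one weight on x_2 and one on the later variables. *)
have [||_ -> ->] := @Lform_eulerian n (fun i => 1 + u i) 2 0.
- by move=> i /u1 ->; ring.
- by move=> i /u2 ->; ring.
have [||_ -> ->] := @Lform_eulerian n (fun i => 1 - u i) 0 2.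
- by move=> i /u1 ->; ring.
- by move=> i /u2 ->; ring.
rewrite !coefD !coefC !coefZ !coefX /= /h /g.
rewrite /ps1 /ps2 /ps3 /eul1 /eul2 /eul3 exp4 !(exprS _ n.+1) -!natr1.
by split; field.
Qed.

End Eulerian.

End Pencil.

(** * Asymptotics *)

From mathcomp Require Import all_classical all_reals all_analysis.
Import numFieldNormedType.Exports.
Import Pencil.

(** * Locating the larger root of a quadratic *)

Section Quadratic.
Variable R : rcfType.
Local Open Scope ring_scope.

(** The expression [u] is the larger root in rationalized form. The quadratic is convex, nonpositive
    at [r] and increasing there, so its tangent at [r] vanishes at or beyond the root. *)
Lemma quadratic_largest_root (a b c r g : R) :
  0 < a -> 0 < b -> 0 < c -> 0 < 2 * c * r - b -> c * r ^+ 2 - b * r + a = - g ^+ 2 ->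
  let u := 2 * a / (b - Num.sqrt (b ^+ 2 - 4 * a * c)) in
  [/\ c * u ^+ 2 - b * u + a = 0, r <= u & u <= r + g ^+ 2 / (2 * c * r - b)].
Proof.
move=> a0 b0 c0; set X := 2 * c * r - b => X0 fr u.
have discE : b ^+ 2 - 4 * a * c = X ^+ 2 + 4 * c * g ^+ 2.
  have -> : g ^+ 2 = - (c * r ^+ 2 - b * r + a) by rewrite fr opprK.
  by rewrite /X; ring.
have gc0 : 0 <= 4 * c * g ^+ 2 by apply: mulr_ge0; [lra | exact: sqr_ge0].
have disc0 : 0 <= b ^+ 2 - 4 * a * c by rewrite discE addr_ge0 ?sqr_ge0.
rewrite /u; set s := Num.sqrt _.
have s2 : s ^+ 2 = b ^+ 2 - 4 * a * c by rewrite sqr_sqrtr.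
have s0 : 0 <= s by apply: sqrtr_ge0.
have bs : b - s != 0.
  apply/eqP => bs; have : 0 < 4 * a * c by rewrite !mulr_gt0.
  have -> : 4 * a * c = (b - s) * (b + s) by rewrite -subr_sqr s2; ring.
  by rewrite bs mul0r ltxx.
have c'0 : c != 0 by rewrite gt_eqF.
have bs2 : (b + s) * (b - s) = 4 * a * c.
  by transitivity (b ^+ 2 - s ^+ 2); [ring | rewrite s2; ring].
have uE : 2 * a / (b - s) = (b + s) / (2 * c).
  have -> : 2 * a = (b + s) * (b - s) / (2 * c) by rewrite bs2; field.
  by field; rewrite c'0.
rewrite uE.
have X'0 : X != 0 by rewrite gt_eqF.
have rE : r = (b + X) / (2 * c) by rewrite /X; field.
have Xs : X <= s by rewrite -ler_sqr ?nnegrE ?(ltW X0) // s2 discE lerDl.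
have sX : s <= X + 2 * c * g ^+ 2 / X.
  have h0 : 0 <= 2 * c * g ^+ 2 / X.
    by apply: divr_ge0 (ltW X0); apply: mulr_ge0; [lra | exact: sqr_ge0].
  rewrite -ler_sqr ?nnegrE //; last by rewrite addr_ge0 // ltW.
  rewrite s2 discE.
  have -> : (X + 2 * c * g ^+ 2 / X) ^+ 2 =
      X ^+ 2 + 4 * c * g ^+ 2 + (2 * c * g ^+ 2 / X) ^+ 2 by field.
  by rewrite lerDl sqr_ge0.
split.
- have -> : c * ((b + s) / (2 * c)) ^+ 2 - b * ((b + s) / (2 * c)) + a =
    (s ^+ 2 - (b ^+ 2 - 4 * a * c)) / (4 * c) by field.
  by rewrite s2 subrr mul0r.
- by rewrite rE ler_pM2r ?lerD2l // invr_gt0 mulr_gt0.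
- have -> : r + g ^+ 2 / X = (b + (X + 2 * c * g ^+ 2 / X)) / (2 * c).
    by rewrite {1}rE; field; rewrite c'0 X'0.
  by rewrite ler_pM2r ?lerD2l // invr_gt0 mulr_gt0.
Qed.

End Quadratic.

(** * Null sequences in T, S, k and limits of the normalised quantities *)

Section Scales.
Variable R : realType.
Local Open Scope classical_set_scope.
Local Open Scope ring_scope.

(* A syntactic wrapper, so that limits of arithmetic expressions can be computed by
   matching on the head symbol. *)
Definition tendsto (f : nat -> R) (l : R) : Prop := f @ \oo --> l.

Lemma tendsto_eq f l l' : tendsto f l -> l = l' -> tendsto f l'.
Proof. by move=> + <-. Qed.

Lemma tendsto_cst c : tendsto (fun=> c) c.
Proof. exact: cvg_cst. Qed.

Lemma tendstoD f g a b : tendsto f a -> tendsto g b -> tendsto (fun n => f n + g n) (a + b).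
Proof. exact: cvgD. Qed.

Lemma tendstoN f a : tendsto f a -> tendsto (fun n => - f n) (- a).
Proof. exact: cvgN. Qed.

Lemma tendstoM f g a b : tendsto f a -> tendsto g b -> tendsto (fun n => f n * g n) (a * b).
Proof. exact: cvgM. Qed.

Lemma tendstoV1 f : tendsto f 1 -> tendsto (fun n => (f n)^-1) 1.
Proof. by rewrite -[X in _ -> tendsto _ X]invr1; apply: cvgV; exact: oner_neq0. Qed.

Ltac tendsto_step :=
  lazymatch goal with
  | |- tendsto (fun _ => ?c) _ => exact (@tendsto_cst c)
  | |- tendsto (fun n => @Algebra.add _ (@?f n) (@?g n)) _ => eapply (@tendstoD f g)
  | |- tendsto (fun n => @Algebra.opp _ (@?f n)) _ => eapply (@tendstoN f)
  | |- tendsto (fun n => @GRing.mul _ (@?f n) (@?g n)) _ => eapply (@tendstoM f g)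
  | |- tendsto (fun n => @GRing.inv _ (@?f n)) _ => eapply (@tendstoV1 f)
  | H : tendsto ?h _ |- tendsto (fun n => ?h n) _ => exact H
  | H : tendsto ?h _ |- tendsto ?h _ => exact H
  end.

Ltac tendsto_arith := eapply tendsto_eq; [solve [repeat tendsto_step] | try (by field)].

Definition pow2s (n : nat) : R := 2 ^+ n.+1.
Definition pow3s (n : nat) : R := 3 ^+ n.+1.
Local Notation T := pow2s.
Local Notation S := pow3s.

(* With T = 2^(n+1), S = 3^(n+1) and k = n+2, every quantity below is its leading monomial in
   T, S, k times a polynomial or rational function of the three null sequences epsA = S/T^2,
   epsB = kT/S and epsD = 1/k; the latter factor is defined first, and the lemmas [_scaled]
   restore the monomial. *)
Definition epsA n : R := S n / T n ^+ 2.
Definition epsB n : R := n.+2%:R * T n / S n.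
Definition epsD n : R := n.+2%:R^-1.

Lemma pow2s_gt0 n : 0 < T n. Proof. by rewrite exprn_gt0. Qed.
Lemma pow3s_gt0 n : 0 < S n. Proof. by rewrite exprn_gt0. Qed.

Lemma cvg_epsA : tendsto epsA 0.
Proof.
have -> : epsA = (fun n => (3 / 4) ^+ n.+1).
  apply/funext => n; rewrite /epsA /T /S exprAC -expr_div_n; congr ((_ / _) ^+ _); ring.
by rewrite /tendsto (cvg_shiftS (fun n => (3 / 4 : R) ^+ n)); 
  apply: cvg_expr; rewrite ger0_norm; lra.
Qed.

Lemma cvg_epsD : tendsto epsD 0.
Proof. by rewrite /tendsto (cvg_shiftS (@harmonic R)); exact: cvg_harmonic. Qed.

(** The rate 5/4 is below 3/2, so that n (2/3)^n is dominated by a multiple of (5/6)^n, where 5/6 =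
    (5/4)(2/3). *)
Lemma linear_le_geometric n : n%:R + 4 <= 4 * (5 / 4) ^+ n :> R.
Proof.
elim: n => [|n IH]; first by rewrite expr0; lra.
rewrite exprS -natr1; have : 0 <= n%:R :> R by [].
by lra.
Qed.

Lemma cvg_epsB : tendsto epsB 0.
Proof.
rewrite /tendsto; apply: (@squeeze_cvgr _ _ _ _ (cst 0) (fun n => 4 * (5 / 6) ^+ n)); first last.
- rewrite -[0 in X in _ --> X](mulr0 4); apply: cvgM; first exact: cvg_cst.
  by apply: cvg_expr; rewrite ger0_norm; lra.
- exact: cvg_cst.
near=> n; apply/andP; split => /=.
  by rewrite /epsB divr_ge0 ?mulr_ge0 ?ltW ?pow2s_gt0 ?pow3s_gt0.
rewrite /epsB ler_pdivrMr ?pow3s_gt0 // /T /S.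
have -> : (4 : R) * (5 / 6) ^+ n * 3 ^+ n.+1 = 4 * (5 / 4) ^+ n * 2 ^+ n * 3.
  have E : (5 / 6) ^+ n * 3 ^+ n = (5 / 4) ^+ n * 2 ^+ n :> R.
    by rewrite -!exprMn; congr (_ ^+ _); field.
  by rewrite exprS mulrCA -!mulrA E; ring.
have := linear_le_geometric n; rewrite exprS -(natr1 n.+1) -(natr1 n).
have : 0 <= n%:R :> R by [].
have : 0 < 2 ^+ n :> R by rewrite exprn_gt0.
move: (2 ^+ n : R) ((5 / 4) ^+ n : R) (n%:R : R) => x y z; nra.
Unshelve. all: by end_near. Qed.

Definition m1s n := 1 - epsA n * epsB n.
Definition m2s n := 1 - 2 * epsA n + epsA n * epsA n * epsB n * epsB n * epsD n.
Definition m3s n :=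
  1 - 3 * epsA n + 3 * epsA n * epsB n * epsD n
  - epsA n * epsB n * epsA n * epsB n * epsA n * epsB n * epsD n * epsD n.
(* rho = (T - m3/m2) / (S/T), lam = (T m1 - m2)/S and gs = (m1 m3/m2 - m2)/S for the power
   sums m1, m2, m3. *)
Definition rho n :=
  (1 - 3 * epsB n * epsD n + epsA n * epsB n * epsB n * epsD n
   + epsA n * epsA n * epsB n * epsB n * epsB n * epsD n * epsD n) / m2s n.
Definition lam n := 2 - epsB n - epsA n * epsB n * epsB n * epsD n.
Definition gs n := lam n - rho n * m1s n.
Definition det0s n := (1 - 2 * epsD n) * m2s n - epsD n * m1s n * m1s n.
Definition det1s n := (1 - 2 * epsD n) * m3s n - epsD n * m1s n * m2s n.
(** The T^4 terms of m1 m3 - m2^2 cancel, so the leading monomial is T^2 S and the factor is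
    expanded in the null sequences directly. *)
Definition det2s n :=
  1 + 3 * epsB n * epsD n - epsB n + 3 * epsA n * epsB n - 4 * epsA n
  - 5 * epsA n * epsB n * epsB n * epsD n
  + 4 * epsA n * epsA n * epsB n * epsB n * epsD n
  - epsA n * epsA n * epsB n * epsB n * epsB n * epsD n * epsD n.
(** The slope of the quadratic at r = m3/m2, divided by k T^3. *)
Definition Xs n := 2 * det0s n * (1 - rho n * epsA n) - det1s n.

(* [tendsto_arith] looks the limits of atoms up among the hypotheses, hence these [Let]s. *)
Let cA := cvg_epsA. Let cB := cvg_epsB. Let cD := cvg_epsD.

Lemma cvg_m1s : tendsto m1s 1. Proof. by rewrite /m1s; tendsto_arith. Qed.
Lemma cvg_m2s : tendsto m2s 1. Proof. by rewrite /m2s; tendsto_arith. Qed.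
Lemma cvg_m3s : tendsto m3s 1. Proof. by rewrite /m3s; tendsto_arith. Qed.
Let ct1 := cvg_m1s. Let ct2 := cvg_m2s. Let ct3 := cvg_m3s.
Lemma cvg_det2s : tendsto det2s 1. Proof. by rewrite /det2s; tendsto_arith. Qed.
Lemma cvg_rho : tendsto rho 1.
Proof. by rewrite /rho; tendsto_arith. Qed.
Let crho := cvg_rho.
Lemma cvg_lam : tendsto lam 2. Proof. by rewrite /lam; tendsto_arith. Qed.
Let clam := cvg_lam.
Lemma cvg_gs : tendsto gs 1. Proof. by rewrite /gs; tendsto_arith. Qed.
Lemma cvg_det0s : tendsto det0s 1. Proof. by rewrite /det0s; tendsto_arith. Qed.
Lemma cvg_det1s : tendsto det1s 1. Proof. by rewrite /det1s; tendsto_arith. Qed.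
Let cgs := cvg_gs. Let ccs := cvg_det0s. Let cbs := cvg_det1s.
Lemma cvg_Xs : tendsto Xs 1. Proof. by rewrite /Xs; tendsto_arith. Qed.

Lemma index_scale n : n%:R = n.+2%:R - 2 :> R.
Proof. by rewrite -(natr1 n.+1) -(natr1 n); ring. Qed.

Lemma scales_neq0 n : [/\ T n != 0, S n != 0 & n.+2%:R != 0 :> R].
Proof. by rewrite !gt_eqF ?pow2s_gt0 ?pow3s_gt0. Qed.

(** * Asymptotics of the univariate bound *)

Definition M1 n : R := T n - n.+2%:R.
Definition M2 n : R := T n ^+ 2 - 2 * S n + n.+2%:R.
Definition M3 n : R := T n ^+ 3 - 3 * T n * S n + 3 * T n ^+ 2 - n.+2%:R.
Definition un n : R := uni_bound R n.

Lemma M1_scaled n : M1 n = T n * m1s n.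
Proof.
have [T0 S0 k0] := scales_neq0 n.
rewrite /M1 /m1s /epsA /epsB.
by move: (n.+2%:R : R) (T n) (S n) T0 S0 k0 => k t s T0 S0 k0; field; rewrite T0 S0.
Qed.

Lemma M2_scaled n : M2 n = T n ^+ 2 * m2s n.
Proof.
have [T0 S0 k0] := scales_neq0 n.
rewrite /M2 /m2s /epsA /epsB /epsD.
by move: (n.+2%:R : R) (T n) (S n) T0 S0 k0 => k t s T0 S0 k0; field; rewrite T0 S0 k0.
Qed.

Lemma M3_scaled n : M3 n = T n ^+ 3 * m3s n.
Proof.
have [T0 S0 k0] := scales_neq0 n.
rewrite /M3 /m3s /epsA /epsB /epsD.
by move: (n.+2%:R : R) (T n) (S n) T0 S0 k0 => k t s T0 S0 k0; field; rewrite T0 S0 k0.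
Qed.

Definition det0 n : R := n%:R * M2 n - M1 n ^+ 2.
Definition det1 n : R := n%:R * M3 n - M1 n * M2 n.
Definition det2 n : R := M1 n * M3 n - M2 n ^+ 2.

Lemma det0_scaled n : det0 n = n.+2%:R * T n ^+ 2 * det0s n.
Proof.
have [T0 S0 k0] := scales_neq0 n.
rewrite /det0 M1_scaled M2_scaled (index_scale n) /det0s /epsD.
by move: (n.+2%:R : R) (T n) (m1s n) (m2s n) T0 k0 => k t x y T0 k0; field.
Qed.

Lemma det1_scaled n : det1 n = n.+2%:R * T n ^+ 3 * det1s n.
Proof.
have [T0 S0 k0] := scales_neq0 n.
rewrite /det1 M1_scaled M2_scaled M3_scaled (index_scale n) /det1s /epsD.
by move: (n.+2%:R : R) (T n) (m1s n) (m2s n) (m3s n) T0 k0 => k t x y z T0 k0; field.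
Qed.

Lemma det2_scaled n : det2 n = T n ^+ 2 * S n * det2s n.
Proof.
have [T0 S0 k0] := scales_neq0 n.
rewrite /det2 /M1 /M2 /M3 /det2s /epsA /epsB /epsD.
by move: (n.+2%:R : R) (T n) (S n) T0 S0 k0 => k t s T0 S0 k0; field; rewrite T0 S0 k0.
Qed.

Definition wid n : R := S n / T n.

Lemma ratio_scaled n : m2s n != 0 -> M3 n / M2 n = T n - rho n * wid n.
Proof.
move=> t20; have [T0 S0 k0] := scales_neq0 n.
apply: (mulIf (_ : M2 n != 0)); first by rewrite M2_scaled mulf_neq0 ?expf_neq0.
rewrite divfK; last by rewrite M2_scaled mulf_neq0 ?expf_neq0.
rewrite M2_scaled /wid /rho.
set q := 1 - _ + _ + _.
have -> : (T n - q / m2s n * (S n / T n)) * (T n ^+ 2 * m2s n) =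
    T n ^+ 3 * m2s n - q * S n * T n by field; rewrite T0.
rewrite /q /M3 /m2s /epsA /epsB /epsD.
by move: (n.+2%:R : R) (T n) (S n) T0 S0 k0 => k t s T0 S0 k0; field; rewrite T0 S0 k0.
Qed.

Lemma uni_bound_quadratic n : (0 < n)%N ->
  un n = 2 * det2 n / (det1 n - Num.sqrt (det1 n ^+ 2 - 4 * det2 n * det0 n)).
Proof. by case: n => // n _; rewrite /un /uni_bound; have [-> -> ->] := uni_det_coefs R n. Qed.

Lemma tendsto1_gt0 f : tendsto f 1 -> \forall n \near \oo, 0 < f n.
Proof. by move=> /cvgr_gt; apply; exact: ltr01. Qed.

(** At r = m3/m2 the product in (m1 - r n)(m3 - r m2) - (m2 - r m1)^2 vanishes, so the quadratic is
    minus a square there and [quadratic_largest_root] traps [un] just above r. In units of S/T the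
    bound on the gap is a null sequence. *)
Lemma uni_bound_bounds : \forall n \near \oo,
  det0 n * un n ^+ 2 - det1 n * un n + det2 n = 0 /\
  0 <= (un n - (T n - rho n * wid n)) / wid n
    <= epsA n * epsD n * gs n * gs n / Xs n.
Proof.
near=> n.
have n0 : (0 < n)%N by near: n; exact: nbhs_infty_gt.
have t20 : 0 < m2s n by near: n; exact: tendsto1_gt0 cvg_m2s.
have a0 : 0 < det2s n by near: n; exact: tendsto1_gt0 cvg_det2s.
have b0 : 0 < det1s n by near: n; exact: tendsto1_gt0 cvg_det1s.
have c0 : 0 < det0s n by near: n; exact: tendsto1_gt0 cvg_det0s.
have X0 : 0 < Xs n by near: n; exact: tendsto1_gt0 cvg_Xs.
have [T0 S0 k0] := scales_neq0 n.
have Tp := pow2s_gt0 n; have Sp := pow3s_gt0 n; have kp : 0 < n.+2%:R :> R by [].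
have rE := ratio_scaled (lt0r_neq0 t20).
set r := T n - rho n * wid n in rE *.
have a'0 : 0 < det2 n by rewrite det2_scaled !mulr_gt0 ?exprn_gt0.
have b'0 : 0 < det1 n by rewrite det1_scaled !mulr_gt0 ?exprn_gt0.
have c'0 : 0 < det0 n by rewrite det0_scaled !mulr_gt0 ?exprn_gt0.
have XE : 2 * det0 n * r - det1 n = n.+2%:R * T n ^+ 3 * Xs n.
  rewrite det0_scaled det1_scaled /r /Xs /wid /epsA.
  by move: (det0s n) (det1s n) (rho n) (n.+2%:R : R) (T n) (S n) T0 => ? ? ? ? t ? T0; field.
have X'0 : 0 < 2 * det0 n * r - det1 n by rewrite XE !mulr_gt0 ?exprn_gt0.
have gE : r * M1 n - M2 n = S n * gs n.
  rewrite /r /gs M1_scaled M2_scaled /wid mulrBr /lam /m2s /m1s /epsA /epsB /epsD.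
  by move: (rho n) (n.+2%:R : R) (T n) (S n) T0 S0 k0 => ? k t s T0 S0 k0; field; rewrite T0 S0.
have fr : det0 n * r ^+ 2 - det1 n * r + det2 n = - (S n * gs n) ^+ 2.
  have M20 : M2 n != 0 by rewrite M2_scaled mulf_neq0 ?expf_neq0 ?lt0r_neq0.
  have r3 : M3 n = r * M2 n by rewrite -rE divfK.
  by rewrite -gE /det0 /det1 /det2 r3; ring.
have := quadratic_largest_root a'0 b'0 c'0 X'0 fr.
rewrite -uni_bound_quadratic // => -[root lo hi]; split=> //.
have wp : 0 < wid n by rewrite divr_gt0.
apply/andP; split; first by rewrite divr_ge0 ?subr_ge0 // ltW.
rewrite ler_pdivrMr // lerBlDl; apply: le_trans hi _; rewrite lerD2l XE le_eqVlt.
apply/orP; left; apply/eqP; rewrite /wid /epsA /epsD.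
by move: (gs n) (Xs n) (lt0r_neq0 X0) (n.+2%:R : R) (T n) (S n) T0 S0 k0
  => ? ? X1 k t s T0 S0 k0; field; rewrite T0 X1 k0.
Unshelve. all: by end_near. Qed.

(** * The multivariate bound at the kernel vector *)

Definition theta n : R := (T n - un n) / wid n.
(** For u = [un], [nu] is (u m1 - m2)/S and [delta] is (u n - m1)/(k T). *)
Definition nu n : R := lam n - theta n * m1s n.
Definition delta n : R := (1 - theta n * epsA n) * (1 - 2 * epsD n) - m1s n * epsD n.
(* [ykernel] is (m2 - u m1)/(m1 - u n) at u = un. *)
Definition keta n : R := nu n / delta n.
Definition ykernel n : R := epsD n * keta n * wid n.
(** At y = [ykernel] and for large n, [multDs] is D/T^2 and [multNs] is (N - un D)/(4 S). *)
Definition multDs n : R :=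
  (1 - 2 * epsD n) * keta n * epsD n * keta n * epsA n * epsA n
  + 2 * epsD n * keta n * epsA n * (2 * (epsA n * epsB n * epsD n) - m1s n) + m2s n
  + 8 * (epsA n * epsB n * epsD n) * (epsA n * epsB n * epsD n)
  - 2 * (epsA n * epsB n * epsD n).
Definition multNs n : R :=
  epsD n * keta n * (theta n * epsA n - epsA n * epsB n * epsD n - 1 / 2)
  + epsB n * epsD n * (1 / 2 - epsA n * epsB n * epsD n)
  + (1 / 2 - epsA n * epsB n * epsD n) * (epsB n - theta n)
  + (2 / 3 - epsB n / 2 - epsB n * epsD n / 2 + epsA n * epsB n * epsB n * epsD n
     - epsA n * epsB n * epsB n * epsD n * epsD n)
  - epsB n * epsD n * (1 - theta n * epsA n).

(** By [uni_bound_bounds], un = m3/m2 + o(S/T), so [theta] has the limit of [rho]. *)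
Lemma cvg_theta : tendsto theta 1.
Proof.
have cX := cvg_Xs.
have hi : tendsto (fun n => epsA n * epsD n * gs n * gs n / Xs n) 0 by tendsto_arith.
pose e n := (un n - (T n - rho n * wid n)) / wid n.
have ce : tendsto e 0.
  rewrite /tendsto; apply: (squeeze_cvgr _ (@cvg_cst _ _ _ _ _) hi).
  by apply: filterS uni_bound_bounds => n [].
have -> : theta = (fun n => rho n - e n).
  apply/funext => n; have [T0 S0 k0] := scales_neq0 n.
  have w0 : wid n != 0 by rewrite mulf_neq0 ?invr_eq0.
  by rewrite /theta /e; move: (un n) (T n) (rho n) (wid n) w0 => u t r w w0; field.
by move: e ce => e ce; tendsto_arith.
Qed.
Let cth := cvg_theta.
Lemma cvg_nu : tendsto nu 1. Proof. by rewrite /nu; tendsto_arith. Qed.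
Lemma cvg_delta : tendsto delta 1. Proof. by rewrite /delta; tendsto_arith. Qed.
Let cnu := cvg_nu. Let cdel := cvg_delta.
Lemma cvg_keta : tendsto keta 1. Proof. by rewrite /keta; tendsto_arith. Qed.
Let cket := cvg_keta.
Lemma cvg_multDs : tendsto multDs 1. Proof. by rewrite /multDs; tendsto_arith. Qed.
(** The limit is 2/3 - 1/2: the first term is twice 3^n over S, the second comes from (u - m1) T/2,
    where u - m1 = k - theta S/T. *)
Lemma cvg_multNs : tendsto multNs (1 / 6). Proof. by rewrite /multNs; tendsto_arith. Qed.

Definition mult_D_closed n (y : R) : R :=
  n%:R * y ^+ 2 + 2 * y * (2 - M1 n) + M2 n + 4 - 4 * (2 ^+ n - 1).
Definition mult_N_closed n (y : R) : R :=
  M1 n * y ^+ 2 + 2 * y * (2 * (2 ^+ n - 1) - M2 n) + M3 n + 4 * (2 ^+ n - 1)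
  - 4 * (M1 n * (2 ^+ n - 1) - (2 * 3 ^+ n - (n%:R + 3) * 2 ^+ n + (n%:R + 1))).

Lemma mult_val n (y : R) : (0 < n)%N ->
  mult_D n y = mult_D_closed n y /\ mult_N n y = mult_N_closed n y.
Proof. by case: n => // n _; apply: mult_form_coefs. Qed.

Lemma halfT n : 2 ^+ n = T n / 2. Proof. by rewrite /T exprS mulrC mulKf. Qed.
Lemma thirdS n : 3 ^+ n = S n / 3. Proof. by rewrite /S exprS mulrC mulKf. Qed.

Lemma un_theta n : un n = T n - theta n * wid n.
Proof.
have [T0 S0 k0] := scales_neq0 n.
by rewrite /theta divfK ?subKr // mulf_neq0 ?invr_eq0.
Qed.

Lemma mult_D_closed_scaled n : mult_D_closed n (ykernel n) = T n ^+ 2 * multDs n.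
Proof.
have [T0 S0 k0] := scales_neq0 n.
rewrite /mult_D_closed halfT (index_scale n) M2_scaled M1_scaled.
rewrite /multDs /ykernel /wid /epsA /epsB /epsD.
move: (keta n) (n.+2%:R : R) (T n) (S n) (m1s n) (m2s n) T0 S0 k0 => x k t s y z T0 S0 k0.
by field; rewrite T0 S0 k0.
Qed.

(* The vector (ykernel, -1) spans the kernel of the univariate pencil at the root -1/un of its
   determinant, so only the terms in which x_2 plays a special role survive in N - un D. *)
Lemma mult_N_closed_scaled n : delta n != 0 ->
  det0 n * un n ^+ 2 - det1 n * un n + det2 n = 0 ->
  mult_N_closed n (ykernel n) = un n * mult_D_closed n (ykernel n) + 4 * S n * multNs n.
Proof.
move=> d0 root; have [T0 S0 k0] := scales_neq0 n.
have denE : un n * n%:R - M1 n = n.+2%:R * T n * delta n.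
  rewrite index_scale un_theta M1_scaled /delta /wid /epsA /epsD.
  move: (theta n) (m1s n) (n.+2%:R : R) (T n) (S n) T0 S0 k0 => x y k t s T0 S0 k0.
  by field; rewrite T0 k0.
have den0 : un n * n%:R - M1 n != 0 by rewrite denE !mulf_neq0.
have yE : (un n * n%:R - M1 n) * ykernel n = un n * M1 n - M2 n.
  have -> : un n * M1 n - M2 n = S n * nu n.
    rewrite un_theta M1_scaled M2_scaled /nu /lam /wid /m2s /m1s /epsA /epsB /epsD.
    move: (theta n) (n.+2%:R : R) (T n) (S n) T0 S0 k0 => x k t s T0 S0 k0.
    by field; rewrite T0 S0.
  rewrite denE /ykernel /keta /wid /epsD.
  move: (nu n) (delta n) (n.+2%:R : R) (T n) (S n) d0 T0 S0 k0 => x y k t s d0 T0 S0 k0.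
  by field; rewrite T0 k0 d0.
have main0 : (M1 n - un n * n%:R) * ykernel n ^+ 2 - 2 * (M2 n - un n * M1 n) * ykernel n
    + (M3 n - un n * M2 n) = 0.
  (* Multiplied by u n - m1, the quadratic form becomes minus the determinant at its root u. *)
  apply: (mulfI den0); rewrite mulr0.
  have -> : (un n * n%:R - M1 n) * ((M1 n - un n * n%:R) * ykernel n ^+ 2 -
      2 * (M2 n - un n * M1 n) * ykernel n + (M3 n - un n * M2 n)) =
    - ((un n * n%:R - M1 n) * ykernel n) ^+ 2
    + 2 * (un n * M1 n - M2 n) * ((un n * n%:R - M1 n) * ykernel n)
    + (un n * n%:R - M1 n) * (M3 n - un n * M2 n) by ring.
  by rewrite yE -[RHS]oppr0 -root /det0 /det1 /det2; ring.
have -> : mult_N_closed n (ykernel n) =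
    un n * mult_D_closed n (ykernel n) + ((M1 n - un n * n%:R) * ykernel n ^+ 2
    - 2 * (M2 n - un n * M1 n) * ykernel n + (M3 n - un n * M2 n)) +
    4 * (ykernel n * (2 ^+ n - 1 - un n) + (2 ^+ n - 1) + un n * (2 ^+ n - 1) - un n -
     (M1 n * (2 ^+ n - 1) - (2 * 3 ^+ n - (n%:R + 3) * 2 ^+ n + (n%:R + 1)))).
  by rewrite /mult_N_closed /mult_D_closed; ring.
rewrite main0 addr0; congr (_ + _).
rewrite halfT thirdS (index_scale n) un_theta M1_scaled.
rewrite /multNs /m1s /ykernel /wid /epsA /epsB /epsD.
move: (keta n) (theta n) (n.+2%:R : R) (T n) (S n) T0 S0 k0 => x y k t s T0 S0 k0.
by field; rewrite T0 S0 k0.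
Qed.

(** Dividing N - un D by D leaves 4 [epsA] [multNs] / [multDs], and (3/4)^n is 4/3 of [epsA], whence
    the factor 6. *)
Lemma mult_uni_difference : \forall n \near \oo,
  [/\ 0 < mult_D n (ykernel n), 0 < mult_N n (ykernel n), 0 < mult_bound n (ykernel n) - un n &
      (mult_bound n (ykernel n) - un n) / (1 / 2 * (3 / 4) ^+ n) = 6 * multNs n / multDs n].
Proof.
near=> n.
have n0 : (0 < n)%N by near: n; exact: nbhs_infty_gt.
have D0 : 0 < multDs n by near: n; exact: tendsto1_gt0 cvg_multDs.
have d0 : 0 < delta n by near: n; exact: tendsto1_gt0 cvg_delta.
have N0 : 0 < multNs n by near: n; apply: (cvgr_gt _ cvg_multNs); lra.
have uT : 0 < 1 - theta n * epsA n.
  by near: n; apply: tendsto1_gt0; tendsto_arith.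
have [root _] : det0 n * un n ^+ 2 - det1 n * un n + det2 n = 0 /\
  0 <= (un n - (T n - rho n * wid n)) / wid n
    <= epsA n * epsD n * gs n * gs n / Xs n by near: n; exact: uni_bound_bounds.
have [T0 S0 k0] := scales_neq0 n.
have Tp := pow2s_gt0 n; have Sp := pow3s_gt0 n.
have u0 : 0 < un n.
  have -> : un n = T n * (1 - theta n * epsA n).
    rewrite un_theta /wid /epsA.
    by move: (theta n) (T n) (S n) T0 => x t s T0; field.
  by rewrite mulr_gt0.
have [DE NE] := mult_val (ykernel n) n0.
have Dp : 0 < mult_D_closed n (ykernel n) by rewrite mult_D_closed_scaled mulr_gt0 ?exprn_gt0.
have NE' := mult_N_closed_scaled (lt0r_neq0 d0) root.
have bE : mult_bound n (ykernel n) - un n = 4 * epsA n * multNs n / multDs n.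
  rewrite /mult_bound DE NE NE' mult_D_closed_scaled /epsA.
  move: (un n) (multDs n) (multNs n) (T n) (S n) T0 (lt0r_neq0 D0) => u x y t s T0 x0.
  by field; rewrite T0 x0.
have A0 : 0 < epsA n by rewrite divr_gt0 ?exprn_gt0.
split.
- by rewrite DE.
- by rewrite NE NE'; apply: addr_gt0; [exact: mulr_gt0 | by rewrite 2?pmulr_rgt0].
- by rewrite bE; apply: divr_gt0 => //; rewrite 2?pmulr_rgt0.
rewrite bE.
have -> : (3 / 4) ^+ n = epsA n * (4 / 3).
  rewrite /epsA /T /S exprAC -expr_div_n.
  have -> : (3 / 2 ^+ 2 : R) = 3 / 4 by congr (_ / _); ring.
  by rewrite exprS; field.
move: (epsA n) (multDs n) (multNs n) (lt0r_neq0 A0) (lt0r_neq0 D0) => a x y a0 x0.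
by field; rewrite a0 x0.
Unshelve. all: by end_near. Qed.

Lemma cvg_difference_ratio : tendsto (fun n => 6 * multNs n / multDs n) 1.
Proof. have c1 := cvg_multDs; have c2 := cvg_multNs; tendsto_arith. Qed.

End Scales.

Local Open Scope classical_set_scope.
Local Open Scope ring_scope.

Theorem proposition18p1 (R : realType) :
  exists y : nat -> R,
    (\forall n \near \oo,
       [/\ 0 < mult_D n (y n), 0 < mult_N n (y n)
         & 0 < mult_bound n (y n) - uni_bound R n]) /\
    (fun n : nat => (mult_bound n (y n) - uni_bound R n) / (1 / 2 * (3 / 4) ^+ n)) @ \oo
      --> (1 : R).
Proof.
exists (@ykernel R); split; first by apply: filterS (mult_uni_difference R) => n [].
have lim : (fun n => 6 * multNs R n / multDs R n) @ \oo --> (1 : R) := @cvg_difference_ratio R.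
apply: cvg_trans lim; apply: near_eq_cvg.
by apply: filterS (mult_uni_difference R) => n [_ _ _ ->].
Qed.
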